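(* Let $R$ be a ring and $I$ an ideal of $R$. Consider the following conditions: (1) Every finitely presented left $R$-module has a projective $I$-cover. (2) For every finitely generated left ideal $K$ of $R$, $R/K$ has a projective $I$-cover. (3) Every cyclically presented left $R$-module has a projective $I$-cover. (4) $R$ is $I$-semiregular. Then $(1)\Rightarrow(2)\Rightarrow(3)\Rightarrow(4)$, and $(4)\Rightarrow(1)$ holds if $R$ is a left PSD ring for $I$.
   Context: Rings are associative with identity; modules are unital left modules; ideals are two-sided. A ''summand'' is a direct summand; a ''projective summand'' is a direct summand that is a projective module. PSD: a submodule $N\leq M$ is PSD in $M$ if for every submodule $X\leq M$ with $N+X=M$ there is a projective summand $S$ of $M$ with $S\leq N$ and $M=S\oplus X$. A module $M$ is PSD for $I$ if every submodule of $IM$ is PSD in $M$. $R$ is a left PSD ring for $I$ if every finitely generated free left $R$-module is PSD for $I$. Projective $I$-cover: a pair $(P,f)$ is a projective $I$-cover of a module $M$ if $P$ is projective, $f:P\to M$ is an epimorphism with $\mathrm{Ker} f\leq IP$, and $\mathrm{Ker} f$ is PSD in $P$. A cyclically presented left $R$-module is one of the form $R/Rr$ with $r\in R$. $I$-semiregular: an element $m$ of a module $M$ is $I$-semiregular if there is a decomposition $M=P\oplus Q$ with $P$ projective, $P\subseteq Rm$ and $Rm\cap Q\subseteq IM$. $M$ is an $I$-semiregular module if each of its elements is $I$-semiregular. The ring $R$ is $I$-semiregular if ${}_RR$ is an $I$-semiregular module. *)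

(* Defs.v *)
From HB Require Import structures.
From mathcomp Require Import all_boot all_algebra.
From mathcomp Require Import generic_quotient boolp.

Set Implicit Arguments.
Unset Strict Implicit.
Unset Printing Implicit Defensive.

Import GRing.Theory.
Local Open Scope ring_scope.
Local Open Scope quotient_scope.

(* Submodules of M are the boolean predicates bundled as [submodClosed M]; as
   [boolp] decides every proposition, these are all the submodules of M. *)

Section SubmoduleType.
Variables (R : pzRingType) (M : lmodType R) (S : submodClosed M).

Definition submodule : Type := {x : M | x \in S}.

HB.instance Definition _ := [isSub of submodule for @sval M (fun x => x \in S)].
HB.instance Definition _ := [Choice of submodule by <:].
HB.instance Definition _ := [SubChoice_isSubLmodule of submodule by <:].

End SubmoduleType.

Section QuotientModule.
Variables (R : pzRingType) (M : lmodType R) (K : submodClosed M).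

Definition quot_equiv (x y : M) : bool := x - y \in K.

Let rpredNK x : x \in K -> - x \in K.
Proof. by move=> xK; rewrite -scaleN1r rpredZ. Qed.

Lemma quot_equiv_is_equiv : equiv_class_of quot_equiv.
Proof.
rewrite /quot_equiv; split => [x|x y|y x z].
- by rewrite subrr rpred0.
- by apply/idP/idP => /rpredNK; rewrite opprB.
- by move=> xy yz; rewrite -(subrKA y) rpredD.
Qed.

Canonical quot_equivRel := EquivRelPack quot_equiv_is_equiv.
Canonical quot_encModRel := defaultEncModRel quot_equiv.

Definition quotient_module : Type := {eq_quot quot_equiv}.

HB.instance Definition _ : EqQuotient M quot_equiv quotient_module :=
  EqQuotient.on quotient_module.
HB.instance Definition _ := Choice.on quotient_module.

Definition quot_zero : quotient_module := \pi_quotient_module 0.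
Definition quot_add (u v : quotient_module) : quotient_module :=
  \pi_quotient_module (repr u + repr v).
Definition quot_opp (u : quotient_module) : quotient_module :=
  \pi_quotient_module (- repr u).
Definition quot_scale (a : R) (u : quotient_module) : quotient_module :=
  \pi_quotient_module (a *: repr u).

Lemma pi_quotP (x y : M) :
  reflect (\pi_quotient_module x = \pi_quotient_module y) (x - y \in K).
Proof. exact: (@eqquotP _ quot_equivRel quotient_module). Qed.

Let repr_piK x : repr (\pi_quotient_module x) - x \in K.
Proof. by apply/pi_quotP; rewrite reprK. Qed.

Lemma quot_ind (P : quotient_module -> Prop) :
  (forall x : M, P (\pi_quotient_module x)) -> forall u, P u.
Proof. by move=> Ppi u; rewrite -(reprK u). Qed.

Lemma quot_addE x y : quot_add (\pi_quotient_module x) (\pi_quotient_module y) =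
  \pi_quotient_module (x + y).
Proof. by apply/pi_quotP; rewrite opprD addrACA rpredD ?repr_piK. Qed.

Lemma quot_oppE x : quot_opp (\pi_quotient_module x) = \pi_quotient_module (- x).
Proof. by apply/pi_quotP; rewrite -opprD rpredNK ?repr_piK. Qed.

Lemma quot_scaleE a x : quot_scale a (\pi_quotient_module x) = \pi_quotient_module (a *: x).
Proof. by apply/pi_quotP; rewrite -scalerBr rpredZ ?repr_piK. Qed.

Fact quot_addA : associative quot_add.
Proof. by elim/quot_ind => x; elim/quot_ind => y; elim/quot_ind => z; rewrite !quot_addE addrA. Qed.
Fact quot_addC : commutative quot_add.
Proof. by elim/quot_ind => x; elim/quot_ind => y; rewrite !quot_addE addrC. Qed.
Fact quot_add0 : left_id quot_zero quot_add.
Proof. by elim/quot_ind => x; rewrite quot_addE add0r. Qed.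
Fact quot_addN : left_inverse quot_zero quot_opp quot_add.
Proof. by elim/quot_ind => x; rewrite quot_oppE quot_addE addNr. Qed.

HB.instance Definition _ := GRing.isZmodule.Build quotient_module
  quot_addA quot_addC quot_add0 quot_addN.

Fact quot_scaleA a b u : quot_scale a (quot_scale b u) = quot_scale (a * b) u.
Proof. by elim/quot_ind: u => x; rewrite !quot_scaleE scalerA. Qed.
Fact quot_scale1 : left_id 1 quot_scale.
Proof. by elim/quot_ind => x; rewrite quot_scaleE scale1r. Qed.
Fact quot_scaleDr : right_distributive quot_scale +%R.
Proof.
move=> a; elim/quot_ind => x; elim/quot_ind => y.
by rewrite [_ + _]quot_addE !quot_scaleE [RHS]quot_addE scalerDr.
Qed.
Fact quot_scaleDl u : {morph quot_scale^~ u : a b / a + b}.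
Proof.
by elim/quot_ind: u => x a b; rewrite !quot_scaleE [RHS]quot_addE scalerDl.
Qed.

HB.instance Definition _ := GRing.Zmodule_isLmodule.Build R quotient_module
  quot_scaleA quot_scale1 quot_scaleDr quot_scaleDl.

Definition quot_proj (x : M) : quotient_module := \pi_quotient_module x.

Fact quot_proj_is_linear : linear quot_proj.
Proof.
move=> a x y.
by rewrite /quot_proj -[RHS]/(quot_add (quot_scale a _) _) quot_scaleE quot_addE.
Qed.

HB.instance Definition _ := GRing.isLinear.Build R M quotient_module *:%R
  quot_proj quot_proj_is_linear.

Lemma quot_proj_surj u : exists x, quot_proj x = u.
Proof. by exists (repr u); rewrite /quot_proj reprK. Qed.

Lemma quot_proj_eq0 x : (quot_proj x == 0) = (x \in K).
Proof.
by apply/eqP/idP => [/pi_quotP|xK]; [|apply/pi_quotP]; rewrite subr0.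
Qed.

End QuotientModule.

Section Submodules.
Variables (R : pzRingType) (M : lmodType R).

Definition kernel (N : lmodType R) (f : {linear M -> N}) : {pred M} :=
  [pred x | f x == 0].

Fact kernel_submod_closed (N : lmodType R) (f : {linear M -> N}) :
  submod_closed (kernel f).
Proof.
split=> [|a x y]; rewrite !inE ?linear0 // => /eqP fx /eqP fy.
by rewrite linearP fx fy scaler0 addr0.
Qed.

HB.instance Definition _ (N : lmodType R) (f : {linear M -> N}) :=
  GRing.isSubmodClosed.Build R M (kernel f) (kernel_submod_closed f).

Definition cyclic_submodule (m : M) : {pred M} :=
  [pred x | `[< exists a : R, x = a *: m >]].

Fact cyclic_submod_closed (m : M) : submod_closed (cyclic_submodule m).
Proof.
split=> [|a x y]; rewrite !inE.
  by apply/asboolP; exists 0; rewrite scale0r.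
move=> /asboolP[b ->] /asboolP[c ->]; apply/asboolP; exists (a * b + c).
by rewrite scalerDl scalerA.
Qed.

HB.instance Definition _ (m : M) :=
  GRing.isSubmodClosed.Build R M (cyclic_submodule m) (cyclic_submod_closed m).

(* I M, the submodule of finite sums of products *)
Definition ideal_mul (I : {pred R}) : {pred M} :=
  [pred x | `[< exists (n : nat) (a : 'I_n -> R) (m : 'I_n -> M),
      (forall i, a i \in I) /\ x = \sum_(i < n) a i *: m i >]].

Definition sum_is_all (N X : {pred M}) : Prop :=
  forall z : M, exists x y : M, [/\ x \in N, y \in X & z = x + y].

Definition direct_sum (N X : {pred M}) : Prop :=
  sum_is_all N X /\ forall x : M, x \in N -> x \in X -> x = 0.

Definition finitely_generated (N : {pred M}) : Prop :=
  exists (n : nat) (g : 'I_n -> M), forall x : M,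
    x \in N <-> exists c : 'I_n -> R, x = \sum_(i < n) c i *: g i.

End Submodules.

Definition two_sided_ideal (R : pzRingType) (I : {pred R}) : Prop :=
  zmod_closed I /\
  forall a x : R, x \in I -> a * x \in I /\ x * a \in I.

Definition surjective (A B : Type) (f : A -> B) : Prop :=
  forall y : B, exists x : A, f x = y.

Section Modules.
Variable R : pzRingType.

Definition projective (P : lmodType R) : Prop :=
  forall (A B : lmodType R) (g : {linear A -> B}) (h : {linear P -> B}),
    surjective g -> exists k : {linear P -> A}, forall x : P, g (k x) = h x.

Definition isomorphic (M N : lmodType R) : Prop :=
  exists f : {linear M -> N}, bijective f.

Definition fg_free (F : lmodType R) : Prop :=
  exists (n : nat) (e : 'I_n -> F), forall x : F,
    exists! c : 'rV[R]_n, x = \sum_(i < n) c ord0 i *: e i.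

Definition finitely_presented (M : lmodType R) : Prop :=
  exists (n : nat) (f : {linear 'rV[R]_n -> M}),
    surjective f /\ finitely_generated (kernel f).

Definition cyclically_presented (M : lmodType R) : Prop :=
  exists r : R^o, isomorphic M (quotient_module (cyclic_submodule r)).

Definition projective_summand (M : lmodType R) (S : submodClosed M) : Prop :=
  (exists T : submodClosed M, direct_sum S T) /\ projective (submodule S).

Definition PSD (M : lmodType R) (N : submodClosed M) : Prop :=
  forall X : submodClosed M, sum_is_all N X ->
    exists S : submodClosed M,
      [/\ projective_summand S, {subset S <= N} & direct_sum S X].

Variable I : {pred R}.

Definition PSD_for (M : lmodType R) : Prop :=
  forall N : submodClosed M, {subset N <= ideal_mul I} -> PSD N.

Definition left_PSD_ring_for : Prop :=
  forall F : lmodType R, fg_free F -> PSD_for F.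

Definition projective_cover (M P : lmodType R) (f : {linear P -> M}) : Prop :=
  [/\ projective P, surjective f, {subset kernel f <= ideal_mul I}
    & PSD (kernel f)].

Definition has_projective_cover (M : lmodType R) : Prop :=
  exists (P : lmodType R) (f : {linear P -> M}), projective_cover f.

Definition semiregular_elt (M : lmodType R) (m : M) : Prop :=
  exists P Q : submodClosed M,
    [/\ direct_sum P Q, projective (submodule P),
        {subset P <= cyclic_submodule m}
      & forall x : M, x \in cyclic_submodule m -> x \in Q ->
          x \in ideal_mul I].

Definition semiregular_module (M : lmodType R) : Prop :=
  forall m : M, semiregular_elt m.

Definition semiregular_ring : Prop := semiregular_module R^o.

End Modules.

(* Main.v *)
(* (3) => (4): lifting [R -> R / R r] to a cover [P] and using PSD to split [P]
   along the image of [R] makes that image projective, so the kernel of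
   [R -> P] is a summand of [R] inside [R r], with complement meeting [R r] in
   the ideal.
   (4) => (1): semiregularity gives every [a] in [R] some [c] with [c a c = c]
   and [a - a c a] in [I].  For a finitely generated [K <= R^n], treating the
   generators entry by entry yields an idempotent [e] of [R^n] with image in
   [K] and [(1 - e) K <= I R^n]; then [ker e -> R^n / K] is a cover. *)

Require Import Defs.
From HB Require Import structures.
From mathcomp Require Import all_boot all_algebra.
From mathcomp Require Import boolp.

Set Implicit Arguments.
Unset Strict Implicit.
Unset Printing Implicit Defensive.

Import GRing.Theory.
Local Open Scope ring_scope.

(** * Linear maps, retracts and projectivity *)

Section LinearMaps.
Variable R : pzRingType.

Lemma linear_exists (A B : lmodType R) (f : A -> B) :
  linear f -> exists g : {linear A -> B}, g =1 f.
Proof.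
move=> lf; pose L := GRing.isLinear.Build R A B *:%R f lf.
pose g : {linear A -> B} := HB.pack f L.
by exists g.
Qed.

Lemma submodB (M : lmodType R) (S : submodClosed M) x y :
  x \in S -> y \in S -> x - y \in S.
Proof. by move=> xS yS; rewrite rpredD // -scaleN1r rpredZ. Qed.

Lemma corestriction (A M : lmodType R) (S : submodClosed M)
    (f : {linear A -> M}) :
  (forall x, f x \in S) ->
  exists g : {linear A -> submodule S}, forall x, val (g x) = f x.
Proof.
move=> fS; have [|g gE] := @linear_exists A (submodule S)
  (fun x => exist (fun y => y \in S) (f x) (fS x)).
  by move=> a x y; apply: val_inj; rewrite [RHS]linearP; apply: (linearP f).
by exists g => x; rewrite gE.
Qed.

Definition preimage (A B : lmodType R) (f : {linear A -> B})
    (X : submodClosed B) : {pred A} := [pred x | f x \in X].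

Fact preimage_submod_closed (A B : lmodType R) (f : {linear A -> B})
  (X : submodClosed B) : submod_closed (preimage f X).
Proof.
split=> [|a x y]; rewrite !inE ?linear0 ?rpred0 // => fx fy.
by rewrite linearP rpredD ?rpredZ.
Qed.

HB.instance Definition _ (A B : lmodType R) (f : {linear A -> B})
    (X : submodClosed B) :=
  GRing.isSubmodClosed.Build R A (preimage f X)
    (preimage_submod_closed f X).

Definition linear_image (A B : lmodType R) (f : {linear A -> B}) : {pred B} :=
  [pred y | `[< exists x, f x = y >]].

Fact linear_image_submod_closed (A B : lmodType R) (f : {linear A -> B}) :
  submod_closed (linear_image f).
Proof.
split=> [|a x y]; rewrite !inE.
  by apply/asboolP; exists 0; rewrite linear0.
move=> /asboolP[u <-] /asboolP[v <-]; apply/asboolP.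
by exists (a *: u + v); rewrite linearP.
Qed.

HB.instance Definition _ (A B : lmodType R) (f : {linear A -> B}) :=
  GRing.isSubmodClosed.Build R B (linear_image f)
    (linear_image_submod_closed f).

(** Lift [h \o p] from [P], then restrict along [i]. All projective submodules below are obtained
    this way. *)
Lemma projective_retract (P Q : lmodType R) (i : {linear Q -> P})
    (p : {linear P -> Q}) :
  cancel i p -> projective P -> projective Q.
Proof.
move=> ipK prP A B g h gsurj.
have [k kE] := prP A B g (h \o p) gsurj.
by exists (k \o i) => x /=; rewrite kE /= ipK.
Qed.

Lemma projective_row n : projective ('rV[R]_n : lmodType R).
Proof.
move=> A B g h gsurj.
have /choice[a aE] : forall i : 'I_n, exists y, g y = h (delta_mx 0 i).
  by move=> i; apply: gsurj.
have [|k kE] := @linear_exists 'rV[R]_n A (fun x => \sum_i x 0 i *: a i).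
  move=> c x y; rewrite scaler_sumr -big_split /=; apply: eq_bigr => i _.
  by rewrite !mxE scalerDl scalerA.
exists k => x; rewrite kE [in RHS](row_sum_delta x) !linear_sum /=.
by apply: eq_bigr => i _; rewrite !linearZ /= aE.
Qed.

Lemma projective_regular : projective (R^o : lmodType R).
Proof.
move=> A B g h gsurj; have [a aE] := gsurj (h 1).
have [|k kE] := @linear_exists R^o A (fun x => x *: a).
  by move=> c x y; rewrite scalerDl scalerA.
by exists k => x; rewrite kE linearZ /= aE -linearZ; congr (h _); apply: mulr1.
Qed.

Lemma row_fg_free n : fg_free ('rV[R]_n : lmodType R).
Proof.
exists n, (fun i => delta_mx 0 i) => x; exists x.
split=> [|c ->]; first exact: row_sum_delta.
exact/esym/row_sum_delta.
Qed.

(** Allows two kernels with the same elements, but of different maps, to be exchanged. *)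
Lemma eq_PSD (M : lmodType R) (N N' : submodClosed M) :
  N =i N' -> PSD N -> PSD N'.
Proof.
move=> eqN psdN X NX; have [z|S [Sproj SN SX]] := psdN X.
  by have [x [y [xN yX zE]]] := NX z; exists x, y; rewrite eqN.
by exists S; split=> // x /SN; rewrite eqN.
Qed.

Lemma ideal_mul_linear (I : {pred R}) (A B : lmodType R)
    (f : {linear A -> B}) x :
  x \in ideal_mul I -> f x \in ideal_mul I.
Proof.
rewrite !inE => /asboolP[n [a [m [aI ->]]]]; apply/asboolP.
exists n, a, (f \o m); split=> //.
by rewrite linear_sum; apply: eq_bigr => i _; rewrite linearZ.
Qed.

End LinearMaps.

(** * Ideals, [I M] in coordinates and weak inverses *)

Section Ideals.
Variables (R : pzRingType) (I : {pred R}).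
Hypothesis idealI : two_sided_ideal I.

Lemma ideal0 : 0 \in I. Proof. by case: idealI => -[]. Qed.

Lemma idealB x y : x \in I -> y \in I -> x - y \in I.
Proof. by case: idealI => -[_ subI] _; apply: subI. Qed.

Lemma idealD x y : x \in I -> y \in I -> x + y \in I.
Proof.
by move=> xI yI; rewrite -[y]opprK -[- y]sub0r !idealB ?ideal0.
Qed.

Lemma idealMl a x : x \in I -> a * x \in I.
Proof. by case: idealI => _ mulI /(mulI a)[]. Qed.

Lemma idealMr a x : x \in I -> x * a \in I.
Proof. by case: idealI => _ mulI /(mulI a)[]. Qed.

Lemma ideal_sum n (F : 'I_n -> R) :
  (forall i, F i \in I) -> \sum_i F i \in I.
Proof.
by move=> FI; elim/big_ind: _ => // [|x y]; [exact: ideal0|exact: idealD].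
Qed.

Lemma ideal_mul_regular (x : R^o) : (x \in ideal_mul I) = (x \in I).
Proof.
rewrite inE; apply/asboolP/idP => [[n [a [m [aI ->]]]]|xI].
  by apply: ideal_sum => i; apply: idealMr.
by exists 1, (fun=> x), (fun=> 1); rewrite big_ord1 -[_ *: _]/(_ * _) mulr1.
Qed.

Lemma ideal_mul_row n (x : 'rV[R]_n) :
  x \in ideal_mul I <-> forall j, x 0 j \in I.
Proof.
split=> [|xI]; rewrite inE.
  move=> /asboolP[k [a [m [aI ->]]]] j; rewrite summxE.
  by apply: ideal_sum => i; rewrite mxE; apply: idealMr.
apply/asboolP; exists n, (fun j => x 0 j), (fun j => delta_mx 0 j).
by split=> //; apply: row_sum_delta.
Qed.

(** Split [1 = p + q] along [R = P (+) Q]: right multiplication by [p] projects onto [P]. As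
    [p = s * a] for some [s], take [c = p * s]; then [a - a * c * a = a * q] lies in [R a] and in
    [Q]. *)
Lemma semiregular_ring_weak_inverse (a : R) : semiregular_ring I ->
  exists c, c * a * c = c /\ a - a * c * a \in I.
Proof.
move=> /(_ a)[P [Q [[PQ PQ0] _ Pa aQ]]].
have [p [q [pP qQ pq1]]] := PQ 1.
have xqE (x : R^o) : x - x * p = x *: q.
  apply: (addrI (x * p)); rewrite addrC subrK.
  by rewrite -[x *: q]/(x * q) -mulrDr -pq1 mulr1.
have Pid (x : R^o) : x \in P -> x * p = x.
  move=> xP; apply/esym/eqP; rewrite -subr_eq0; apply/eqP.
  apply: PQ0; last by rewrite xqE rpredZ.
  by apply: submodB => //; rewrite -[x * p]/(x *: p) rpredZ.
have /Pa := pP; rewrite inE => /asboolP[s ps].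
have psa : s * a = p by rewrite ps.
exists (p * s); split.
  by rewrite -(mulrA p s a) psa Pid // mulrA Pid.
rewrite -!mulrA psa Pid // -ideal_mul_regular.
apply: aQ; last by rewrite xqE rpredZ.
rewrite inE; apply/asboolP; exists (1 - a * s).
by rewrite -[RHS]/(_ * _) mulrBl mul1r -mulrA psa.
Qed.

(** * Idempotents into a submodule of [R^n] and the resulting covers *)

Section IdempotentIntoSubmodule.
Hypothesis semiregR : semiregular_ring I.
Variables (n : nat) (K : submodClosed 'rV[R]_n).
Implicit Types (e : {linear 'rV[R]_n -> 'rV[R]_n}) (m x : 'rV[R]_n).

Definition idempotent_into e : Prop :=
  (forall x, e (e x) = e x) /\ forall x, e x \in K.

(* With [c] a weak inverse of the [j]-th entry of [g := m - e m], the map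
   [phi x := (x_j * c) g] is an idempotent with [e phi = 0], so that
   [e + phi (1 - e)] is again idempotent, with complement [(1 - phi) (1 - e)]. *)
Lemma idempotent_into_step e m j : idempotent_into e -> m \in K ->
  exists e', [/\ idempotent_into e',
    forall x, (forall i, (x - e x) 0 i \in I) ->
      forall i, (x - e' x) 0 i \in I,
    (m - e' m) 0 j \in I
  & forall i, (m - e m) 0 i \in I -> (m - e' m) 0 i \in I].
Proof.
move=> [ee eK] mK; pose g := m - e m.
have gK : g \in K by apply: submodB.
have eg : e g = 0 by rewrite linearB /= ee subrr.
have [c [cac acaI]] := semiregular_ring_weak_inverse (g 0 j) semiregR.
pose phi (x : 'rV[R]_n) := (x 0 j * c) *: g.
have [|e' e'E] := @linear_exists R _ _ (fun x => e x + phi (x - e x)).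
  move=> a x y; rewrite /phi /= [X in _ = X + _]scalerDr [RHS]addrACA -linearP; congr (_ + _).
  rewrite scalerA -scalerDl; congr (_ *: _).
  rewrite linearP !mxE mulrA -mulrDl; congr (_ * _).
  by rewrite mulrBr opprD addrACA.
have compl x i : (x - e' x) 0 i = (x - e x) 0 i - (x - e x) 0 j * c * g 0 i.
  rewrite e'E opprD addrA /phi.
  by rewrite [LHS]mxE [in X in _ + X]mxE [in X in _ - X]mxE.
exists e'; split.
- split=> x; last by rewrite e'E rpredD ?rpredZ.
  (* Since [e] kills [g], idempotence of [e'] reduces to that of [phi], that is to
     [c * a * c = c]. *)
  have eK' : e (e' x) = e x.
    by rewrite e'E linearD /= ee linearZ /= eg scaler0 addr0.
  have phiE : e' x - e x = phi (x - e x) by rewrite e'E addrC addKr.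
  rewrite e'E eK' phiE [RHS]e'E; congr (_ + _).
  by rewrite /phi mxE -!mulrA (mulrA c) cac.
(* The correction is a right multiple of [(x - e x)_j]; in the last item it is a left multiple of
   [g_i]. *)
- move=> x xI i; rewrite compl idealB // -mulrA idealMr //; exact: xI.
- by rewrite compl.
- by move=> i mI; rewrite compl idealB // idealMl.
Qed.

(** Runs the step over all columns. The clause on arbitrary [x] protects generators treated
    earlier. *)
Lemma idempotent_into_elt e m : idempotent_into e -> m \in K ->
  exists e', [/\ idempotent_into e',
    forall x, (forall i, (x - e x) 0 i \in I) ->
      forall i, (x - e' x) 0 i \in I
  & forall i, (m - e' m) 0 i \in I].
Proof.
move=> eid mK.
suff [e' [e'id pres mI]] : exists e', [/\ idempotent_into e',
    forall x, (forall i, (x - e x) 0 i \in I) ->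
      forall i, (x - e' x) 0 i \in I
  & forall i, i \in enum 'I_n -> (m - e' m) 0 i \in I].
  by exists e'; split=> // i; apply: mI; rewrite mem_enum.
elim: (enum _) => [|j s [f [fid pres mI]]]; first by exists e.
have [e' [e'id pres' jI mI']] := idempotent_into_step j fid mK.
exists e'; split=> // [x xI|i]; first exact/pres'/pres.
by rewrite inE => /predU1P[->//|/mI/mI'].
Qed.

Lemma idempotent_into_finitely_generated : finitely_generated K ->
  exists e, idempotent_into e /\
    forall x, x \in K -> x - e x \in ideal_mul I.
Proof.
move=> [k [g Kg]].
have gK i : g i \in K.
  apply/Kg; exists (fun j => (j == i)%:R).
  rewrite (bigD1 i) //= eqxx scale1r big1 ?addr0 // => j /negPf->.
  by rewrite scale0r.
suff [e [eid gI]] : exists e, idempotent_into e /\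
    forall i, i \in enum 'I_k -> forall j, (g i - e (g i)) 0 j \in I.
  exists e; split=> // x /Kg[c ->]; apply/ideal_mul_row => j.
  rewrite linear_sum -sumrB summxE; apply: ideal_sum => i.
  by rewrite linearZ -scalerBr mxE idealMl // gI ?mem_enum.
(* Induction on the generators treated so far, starting from [e = 0]. *)
elim: (enum _) => [|i s [e [eid gI]]].
  have [|e eE] := @linear_exists R 'rV[R]_n 'rV[R]_n (fun=> 0).
    by move=> a x y; rewrite scaler0 addr0.
  by exists e; split=> //; split=> x; rewrite !eE ?rpred0.
have [e' [e'id pres iI]] := idempotent_into_elt eid (gK i).
exists e'; split=> // i'; rewrite inE => /predU1P[->//|/gI]; exact: pres.
Qed.

End IdempotentIntoSubmodule.

(* The cover is the restriction of [f] to [ker e], of which [1 - e] is a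
   retraction; splitting off [ker e] carries PSD from ['rV_n] to [ker e]. *)
Lemma finitely_presented_projective_cover (M : lmodType R) :
  semiregular_ring I -> left_PSD_ring_for I -> finitely_presented M ->
  has_projective_cover I M.
Proof.
move=> semiregR psdR [n [f [fsurj Kfg]]].
have [e [[ee eK] eI]] := idempotent_into_finitely_generated semiregR Kfg.
have fe x : f (e x) = 0 by have := eK x; rewrite inE => /eqP.
pose P := submodule (kernel e); pose incl : {linear P -> 'rV[R]_n} := val.
have ecompl x : (idfun \- e) x \in kernel e.
  by rewrite inE /= linearB /= ee subrr.
have [r rE] := corestriction ecompl.
have inclr x : incl (r x) = x - e x by exact: rE.
have eincl p : e (incl p) = 0 by have := valP p; rewrite inE => /eqP.
have inclK : cancel incl r.
  by move=> p; apply: val_inj; rewrite rE /= eincl subr0.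
have inclrid x : e x = 0 -> incl (r x) = x by rewrite inclr => ->; rewrite subr0.
pose g : {linear P -> M} := f \o incl.
have gr x : g (r x) = f x by rewrite -[g _]/(f (incl (r x))) inclr linearB fe subr0.
exists P, g; split.
- exact: projective_retract inclK (@projective_row R n).
- by move=> y; have [x <-] := fsurj y; exists (r x).
(* Applying [r] to [incl p], which lies in [I R^n], gives membership in [I P] itself. *)
- move=> p; rewrite inE => /eqP gp; rewrite -(inclK p).
  apply: ideal_mul_linear; rewrite -[incl p]subr0 -(eincl p).
  by apply: eI; rewrite inE; apply/eqP.
move=> X kerX.
(* The kernel of [g] seen inside [R^n]. Its PSD property is applied to the preimage of [X] under
   [r]. *)
pose N : submodClosed 'rV[R]_n :=
  linear_image (incl \o (val : {linear submodule (kernel g) -> P})).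
have NP x : x \in N <-> e x = 0 /\ f x = 0.
  rewrite inE; split=> [/asboolP[p <-]|[ex fx]].
    by split; [exact: eincl|have := valP p; rewrite inE => /eqP].
  have rg : r x \in kernel g by rewrite inE gr fx.
  by apply/asboolP; exists (exist _ (r x) rg); apply: inclrid.
have NI : {subset N <= ideal_mul I}.
  move=> x /NP[ex fx]; rewrite -[x]subr0 -ex.
  by apply: eI; rewrite inE fx.
have [z|S [[_ Sproj] SN [SX SX0]]] :=
    psdR _ (@row_fg_free R n) N NI (preimage r X).
  have [p [q [pg qX rz]]] := kerX (r z).
  exists (incl p), (z - incl p); split; last by rewrite addrC subrK.
    by apply/NP; split; [exact: eincl|move: pg; rewrite inE => /eqP].
  by rewrite inE linearB /= inclK rz addrC addKr.
have Se s : s \in S -> e s = 0 by case/SN/NP.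
pose T : submodClosed P := preimage incl S.
exists T.
have SPX : direct_sum T X.
  split=> [p|p pS pX].
    have [s [x [sS xX px]]] := SX (incl p).
    exists (r s), (r x); split=> //; last by rewrite -linearD -px inclK.
    by rewrite inE inclrid // Se.
  apply: (can_inj inclK); rewrite linear0; apply: SX0 => //.
  by rewrite inE inclK.
split=> //.
- split; first by exists X.
  (* [incl] and [r] restrict to maps between [T] and [S] that make [T] a retract of [S]. *)
  have [a|i iE] := @corestriction _ (submodule T) _ S
    (incl \o (val : {linear submodule T -> P})).
    exact: valP a.
  have [b|j jE] := @corestriction _ (submodule S) _ T
    (r \o (val : {linear submodule S -> 'rV[R]_n})).
    have bS : val b \in S by exact: valP b.
    by rewrite inE (_ : incl _ = val b) //; apply/inclrid/Se.
  apply: (projective_retract (i := i) (p := j)) Sproj => a; apply: val_inj.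
  by rewrite jE /= iE /= inclK.
- by move=> p /SN/NP[_ fp]; rewrite inE; apply/eqP.
Qed.

End Ideals.

(** * Covers under isomorphism, quotients of [R], and semiregularity from covers *)

Lemma has_projective_cover_isomorphic (R : pzRingType) (I : {pred R})
    (M N : lmodType R) :
  isomorphic M N -> has_projective_cover I N -> has_projective_cover I M.
Proof.
move=> [f [g fK gK]] [P [h [Pproj hsurj hI hpsd]]].
have [|k kE] := linear_exists (f := g).
  by move=> a x y; apply: (can_inj fK); rewrite linearP !gK.
have kerE : kernel h =i kernel (k \o h).
  move=> x; rewrite !inE /= kE; apply/eqP/eqP => [->|/(congr1 f)].
    by rewrite -kE linear0.
  by rewrite gK linear0.
exists P, (k \o h); split=> //.
- by move=> y; have [x hx] := hsurj (f y); exists x; rewrite /= kE hx fK.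
- by move=> x; rewrite -kerE; apply: hI.
- exact: eq_PSD kerE hpsd.
Qed.

Lemma finitely_presented_quotient (R : pzRingType) (K : submodClosed R^o) :
  finitely_generated K -> finitely_presented (quotient_module K).
Proof.
move=> [k [g Kg]].
have [|f fE] := @linear_exists R 'rV[R]_1 (quotient_module K)
  (fun x => quot_proj K (x 0 0)).
  by move=> a x y; rewrite !mxE -linearP.
exists 1, f; split=> [y|].
  by have [x <-] := quot_proj_surj y; exists (const_mx x); rewrite fE mxE.
exists k, (fun i => const_mx (g i)) => x.
rewrite inE fE quot_proj_eq0; split=> [/Kg[c xc]|[c ->]].
  exists c; apply/rowP => i; rewrite ord1 xc summxE.
  by apply: eq_bigr => j _; rewrite !mxE.
apply/Kg; exists c; rewrite summxE.
by apply: eq_bigr => j _; rewrite !mxE.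
Qed.

Lemma finitely_generated_cyclic (R : pzRingType) (M : lmodType R) (m : M) :
  finitely_generated (cyclic_submodule m).
Proof.
exists 1, (fun=> m) => x; rewrite inE; split=> [/asboolP[a ->]|[c ->]].
  by exists (fun=> a); rewrite big_ord1.
by apply/asboolP; exists (c 0); rewrite big_ord1.
Qed.

(* Lift [R -> R / R r] to [h : R -> P] and then [P -> P / S], where
   [P = S (+) im h] and [S <= ker f], through [R -> P -> P / S] to [k : P -> R].
   Then [h k h = h], so [k h] is an idempotent with kernel inside [R r]. *)
Lemma semiregular_elt_of_cover (R : pzRingType) (I : {pred R}) (r : R^o) :
  has_projective_cover I (quotient_module (cyclic_submodule r)) ->
  semiregular_elt I r.
Proof.
move=> [P [f [Pproj fsurj fI fpsd]]].
have [h fh] := @projective_regular R _ _ f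
  (quot_proj (cyclic_submodule r)) fsurj.
have memE x : (x \in cyclic_submodule r) = (h x \in kernel f).
  by rewrite [RHS]inE fh; apply/esym/quot_proj_eq0.
(* [ker f + im h = P] because [f \o h] is the surjection [R -> R / R r]. *)
have [p|S [_ Sf [SX SX0]]] := fpsd (linear_image h).
  have [x xE] := quot_proj_surj (f p).
  exists (p - h x), (h x); split; last by rewrite subrK.
    by rewrite inE linearB /= fh -xE subrr.
  by rewrite inE; apply/asboolP; exists x.
have [|k kE] := Pproj _ _ (quot_proj S \o h) (quot_proj S).
  move=> u; have [p <-] := quot_proj_surj u.
  have [s [y [sS]]] := SX p; rewrite inE => /asboolP[x <-] pE.
  exists x; rewrite /= pE linearD /=.
  by move: sS; rewrite -quot_proj_eq0 => /eqP ->; rewrite add0r.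
(* The difference lies in [S] by the choice of [k], and in [im h]; these meet in [0]. *)
have hkh x : h (k (h x)) = h x.
  apply/eqP; rewrite -subr_eq0; apply/eqP/SX0.
    by rewrite -quot_proj_eq0 linearB subr_eq0; apply/eqP/kE.
  by rewrite inE; apply/asboolP; exists (k (h x) - x); rewrite linearB.
pose q : {linear R^o -> R^o} := idfun \- (k \o h).
have qker x : q x \in kernel h by rewrite inE /q /= linearB /= hkh subrr.
exists (kernel h : submodClosed R^o), (kernel q : submodClosed R^o); split.
- split=> [x|x].
    exists (q x), (k (h x)); split=> //; last by rewrite /q /= subrK.
    by rewrite inE /q /= hkh subrr.
  by rewrite !inE /q /= => /eqP ->; rewrite linear0 subr0 => /eqP.
- have [j jE] := corestriction qker.
  apply: (projective_retract (i := val) (p := j)); last exact: projective_regular.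
  move=> x; apply: val_inj; rewrite jE /q /=.
  by have := valP x; rewrite inE => /eqP ->; rewrite linear0 subr0.
- move=> x; rewrite inE => /eqP hx.
  by rewrite memE inE hx linear0.
(* Here [x = k (h x)] with [h x] in [ker f], hence in [I P]; linear maps carry [I P] into [I R]. *)
move=> x; rewrite memE => fhx.
rewrite inE /q /= subr_eq0 => /eqP ->.
by apply: ideal_mul_linear; apply: fI.
Qed.

Theorem theorem2p10 (R : pzRingType) (I : {pred R}) (hI : two_sided_ideal I) :
  let cond1 := forall M : lmodType R,
    finitely_presented M -> has_projective_cover I M in
  let cond2 := forall K : submodClosed R^o,
    finitely_generated K -> has_projective_cover I (quotient_module K) in
  let cond3 := forall M : lmodType R,
    cyclically_presented M -> has_projective_cover I M in
  let cond4 := semiregular_ring I in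
  [/\ cond1 -> cond2, cond2 -> cond3, cond3 -> cond4
    & left_PSD_ring_for I -> cond4 -> cond1].
Proof.
move=> cond1 cond2 cond3 cond4; split.
- by move=> c1 K /finitely_presented_quotient/c1.
- move=> c2 M [r /has_projective_cover_isomorphic]; apply.
  exact/c2/finitely_generated_cyclic.
(* [R / R r] is cyclically presented through the identity map. *)
- move=> c3 r; apply/semiregular_elt_of_cover/c3; exists r.
  by exists idfun; exists idfun.
- by move=> psdR semiregR M; apply: finitely_presented_projective_cover.
Qed.
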